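(* Let $\mathcal N$ be a finite abelian network with total alphabet $A$, and let $\mathbf x.\mathbf q$ be a configuration of $\mathcal N$. If $w_1$ and $w_2$ are two legal executions for $\mathbf x.\mathbf q$, then there exists $w\in A^*$ such that $w_1w$ is a legal execution for $\mathbf x.\mathbf q$ and $|w_1|+|w|=\max(|w_1|,|w_2|)$ (coordinatewise maximum).
   Context: Abelian networks. $\mathbb N=\{0,1,2,\dots\}$. Let $G=(V,E)$ be a finite directed graph (self-loops and multiple edges allowed). An abelian network $\mathcal N$ on $G$ assigns to each $v\in V$ a nonempty input alphabet $A_v$ and a nonempty state space $Q_v$ (the $A_v$ pairwise disjoint), maps $T_a:Q_v\to Q_v$ for $a\in A_v$, and, for each edge $e$ from $v$ to $u$, a message-passing function $T_e:Q_v\times A_v\to A_u^*$ (free monoid of words), such that for all $v$, $a,b\in A_v$, $q\in Q_v$: $T_aT_b=T_bT_a$, and for every edge $e$ out of $v$ the words $T_e(q,a)T_e(T_a(q),b)$ and $T_e(q,b)T_e(T_b(q),a)$ agree up to permuting letters. Put $A=\bigsqcup_v A_v$, $Q=\prod_v Q_v$; $\mathcal N$ is finite if $A$ and $Q$ are finite. For a word $w\in A^*$, $|w|\in\mathbb N^A$ counts the occurrences of each letter. For $a\in A_v$, $\mathbf q\in Q$: $t_a\mathbf q$ is $\mathbf q$ with $\mathbf q(v)$ replaced by $T_a(\mathbf q(v))$, and $\mathbf M_a(\mathbf q)=\sum_{e\text{ out of }v}|T_e(\mathbf q(v),a)|\in\mathbb N^A$. A configuration is a pair $\mathbf x.\mathbf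 q$ with $\mathbf x\in\mathbb Z^A$, $\mathbf q\in Q$; $\pi_a(\mathbf x.\mathbf q)=(\mathbf x+\mathbf M_a(\mathbf q)-|a|).t_a\mathbf q$, and $\pi_w=\pi_{a_\ell}\cdots\pi_{a_1}$ for $w=a_1\cdots a_\ell$. The word $w=a_1\cdots a_\ell$ is a legal execution for $\mathbf x.\mathbf q$ if, with $\mathbf x_i.\mathbf q_i=\pi_{a_1\cdots a_i}(\mathbf x.\mathbf q)$, $\mathbf x_{i-1}(a_i)\ge1$ for all $1\le i\le\ell$. *)

(* Defs.v *)
From HB Require Import structures.
From mathcomp Require Import all_boot all_order all_algebra.

Set Implicit Arguments.
Unset Strict Implicit.
Unset Printing Implicit Defensive.

Import GRing.Theory Num.Theory.

(* Finite directed multigraph: [edge v u] is the finite type of edges from [v]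
   to [u], so loops and parallel edges are allowed. Indexing edges by both
   endpoints lets message-passing functions be typed without casts. *)
Record digraph := Digraph {
  vertex :> finType;
  edge : vertex -> vertex -> finType
}.

(* Only finite networks are considered: the finiteness of the alphabets and of
   the state spaces is carried by [finType]. Disjointness of the alphabets is
   obtained by taking tagged letters, see [letter]. *)
Record finite_abelian_network (G : digraph) := FiniteAbelianNetwork {
  alphabet : G -> finType;
  local_state : G -> finType;
  alphabet_nonempty : forall v, 0 < #|alphabet v|;
  local_state_nonempty : forall v, 0 < #|local_state v|;
  transition : forall v, alphabet v -> local_state v -> local_state v;
  message : forall v u, edge v u ->
    local_state v -> alphabet v -> seq (alphabet u);
  transitionC : forall v (a b : alphabet v) (q : local_state v),
    transition a (transition b q) = transition b (transition a q);
  message_perm : forall v u (e : edge v u) (a b : alphabet v)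
      (q : local_state v),
    perm_eq (message e q a ++ message e (transition a q) b)
            (message e q b ++ message e (transition b q) a)
}.

Section Network.

Variables (G : digraph) (N : finite_abelian_network G).

Definition letter : finType := {v : G & alphabet N v}.

Definition state : finType := {dffun forall v : G, local_state N v}.

Definition config : Type := {ffun letter -> int} * state.

(* |w| *)
Definition letter_count (w : seq letter) (b : letter) : nat := count_mem b w.

(* t_a q *)
Definition global_transition (a : letter) (q : state) : state :=
  [ffun v => dfwith q (transition (tagged a) (q (tag a))) v].

(* M_a(q) *)
Definition message_count (a : letter) (q : state) (b : letter) : nat :=
  \sum_(u : G) \sum_(e : edge (tag a) u)
    letter_count [seq Tagged (alphabet N) c
                 | c <- message e (q (tag a)) (tagged a)] b.

(* pi_a(x.q) *)
Definition process (a : letter) (c : config) : config :=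
  ([ffun b => c.1 b + (message_count a c.2 b)%:Z
                    - (letter_count [:: a] b)%:Z]%R,
   global_transition a c.2).

(* pi_w(x.q); the first letter of [w] is processed first *)
Definition execute (w : seq letter) (c : config) : config :=
  foldl (fun c' a => process a c') c w.

(* The letter in (0-based) position [i] of [w] must be available after the
   [i] letters preceding it have been processed. *)
Definition legal_execution (w : seq letter) (c : config) : Prop :=
  forall i : 'I_(size w),
    (1 <= (execute (take i w) c).1 (tnth (in_tuple w) i))%R.

End Network.

(* Main.v *)
(** Processing letters commutes, so a letter [a] that is available now may be
    moved to the front of any legal execution: no other letter can make [a]
    unavailable, and firing [a] early takes away no other letter.
    Moving the letters of [w1] to the front of [w2] one by one and keeping what
    remains of [w2] gives the required [w]. *)
Require Import Defs.
From mathcomp Require Import all_boot all_order all_algebra.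
From mathcomp Require Import zify.

Set Implicit Arguments.
Unset Strict Implicit.
Unset Printing Implicit Defensive.

Import Order.TTheory GRing.Theory Num.Theory.

Section Exchange.

Variables (G : digraph) (N : finite_abelian_network G).
Implicit Types (a b : letter N) (w : seq (letter N)) (c : config N).

Lemma legal_execution_nil c : legal_execution [::] c.
Proof. by case. Qed.

(** Recursive form of the indexed definition, on which both later inductions run. *)
Lemma legal_execution_cons a w c :
  legal_execution (a :: w) c <->
  (1 <= c.1 a)%R /\ legal_execution w (process a c).
Proof.
split=> [legal_aw | [a_avail legal_w] [[|i] lt_i]].
- split; first by have := legal_aw ord0; rewrite (tnth_nth a).
  move=> i; have := legal_aw (lift ord0 i).
  by rewrite !(tnth_nth a).
- by rewrite (tnth_nth a).
- have := legal_w (Ordinal (lt_i : i < size w)).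
  by rewrite !(tnth_nth a).
Qed.

Lemma global_transition_in v (a : alphabet N v) (q : state N) :
  global_transition (Tagged (alphabet N) a) q v = transition a (q v).
Proof. by rewrite ffunE dfwith_in. Qed.

Lemma global_transition_out a (q : state N) v :
  tag a != v -> global_transition a q v = q v.
Proof. by move=> a_v; rewrite ffunE dfwith_out. Qed.

Lemma global_transitionC a b (q : state N) :
  global_transition a (global_transition b q) =
  global_transition b (global_transition a q).
Proof.
case: a b => [v a] [u b]; apply/ffunP => x.
have [v_x | v_x] := eqVneq v x; have [u_x | u_x] := eqVneq u x.
- by subst; rewrite !global_transition_in transitionC.
- subst x; rewrite global_transition_in [RHS]global_transition_out //.
  by rewrite global_transition_in global_transition_out.
- subst x; rewrite global_transition_out // !global_transition_in.
  by rewrite global_transition_out.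
- by rewrite !global_transition_out.
Qed.

(** At distinct vertices neither letter changes the state that the other reads; at a common vertex
    [message_perm] applies edge by edge. *)
Lemma message_countC a b (q : state N) d :
  message_count a q d + message_count b (global_transition a q) d =
  message_count b q d + message_count a (global_transition b q) d.
Proof.
case: a b => [v a] [u b]; have [u_v | u_v] := eqVneq v u; last first.
  by rewrite addnC /message_count /= !global_transition_out //= eq_sym.
subst u; rewrite /message_count /= !global_transition_in -!big_split /=.
apply: eq_bigr => u _; rewrite -!big_split; apply: eq_bigr => e _ /=.
rewrite /letter_count -!count_cat -!map_cat.
exact/permP/perm_map/message_perm.
Qed.

Lemma processC a b c : process a (process b c) = process b (process a c).
Proof.
rewrite /process /= global_transitionC; congr (_, _); apply/ffunP => d.
rewrite !ffunE; move: (message_countC a b c.2 d) (c.1 d).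
move: (message_count a _ d) (message_count b _ d) => k l.
move: (message_count b _ d) (message_count a _ d) => m n.
move: ((a == d) + 0) ((b == d) + 0) => i j. lia.
Qed.

(** Only the processed letter is consumed, while messages can only add letters. *)
Lemma le_process a b c : a != b -> (c.1 b <= (process a c).1 b)%R.
Proof. by move=> /negPf a_b; rewrite ffunE /letter_count /= a_b; lia. Qed.

(** Letters before the first [a] in [w] stay available by [le_process], and [processC] carries the
    early firing of [a] past them. Once that [a] is reached, both executions are in the same
    configuration; if there is none, [rem] leaves [w] unchanged. *)
Lemma legal_execution_rem a w c :
  (1 <= c.1 a)%R -> legal_execution w c ->
  legal_execution (rem a w) (process a c).
Proof.
elim: w c => [|b w IHw] c a_avail; first by move=> _; apply: legal_execution_nil.
move=> /legal_execution_cons [b_avail legal_w] /=.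
have [<- // | b_a] := eqVneq b a.
apply/legal_execution_cons; split.
  by apply: le_trans b_avail (le_process _ _); rewrite eq_sym.
by rewrite processC; apply: IHw legal_w; apply: le_trans a_avail (le_process _ _).
Qed.

End Exchange.

Theorem lemma4p4 (G : digraph) (N : finite_abelian_network G)
    (c : config N) (w1 w2 : seq (letter N)) :
  legal_execution w1 c -> legal_execution w2 c ->
  exists w : seq (letter N),
    legal_execution (w1 ++ w) c /\
    forall a : letter N,
      letter_count w1 a + letter_count w a =
      maxn (letter_count w1 a) (letter_count w2 a).
Proof.
(* Both [w2] and [c] must vary: the induction hypothesis is used at [rem b w2] and [process b c]. *)
elim: w1 w2 c => [|b w1 IHw1] w2 c.
  by move=> _ legal_w2; exists w2; split=> // a; rewrite max0n.
move=> /legal_execution_cons [b_avail legal_w1] legal_w2.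
have [w [legal_w1w count_w]] :=
  IHw1 _ _ legal_w1 (legal_execution_rem b_avail legal_w2).
exists w; split=> [|a]; first exact/legal_execution_cons.
rewrite /letter_count /= -addnA [X in _ + X](count_w a) /letter_count.
rewrite count_rem /= addn_maxr [b == a]eq_sym.
have [<- | a_b] := eqVneq a b; last by rewrite andbF subn0.
(* If [a] occurs in [w2], the added 1 restores the removed copy. Otherwise nothing was removed, and
   the extra 1 is absorbed by the other argument of the maximum, which is at least 1. *)
rewrite andbT; have [a_w2 | a_w2] := boolP (a \in w2).
  by rewrite subnKC // -has_count has_pred1.
by rewrite (count_memPn a_w2); lia.
Qed.
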